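(* Let $(\xi_l)_{l\ge0}$ be a subordinator with Laplace–Bernstein exponent $\Phi\not\equiv0$, let $\mathcal R$ be its remainder and $R(r)=\mathbb E[\mathcal R^{r-1}]$. Then for every $r>0$, \[ R(r)=\lim_{n\to\infty}\ \prod_{j=0}^{n-1}\frac{\Phi(j+1)}{\Phi(j+r)}\,\bigl(\Phi(n)\bigr)^{r-1}. \]
   Context: $\Phi$ is defined by $\mathbb E[e^{-s\xi_l}]=e^{-l\Phi(s)}$ ($l,s\ge0$). The remainder $\mathcal R$ is the positive random variable whose law is determined by its moments $\mathbb E[\mathcal R^n]=\Phi(1)\cdots\Phi(n)$, $n\ge1$ (its existence is known, and $\mathbf e\overset{\mathrm{law}}{=}\mathcal I\cdot\mathcal R$ with $\mathcal I=\int_0^\infty e^{-\xi_l}\mathrm dl$ independent of $\mathcal R$ and $\mathbf e$ standard exponential). *)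

(* Defs.v *)
From HB Require Import structures.
From mathcomp Require Import all_boot all_order all_algebra.
From mathcomp Require Import all_classical all_reals all_analysis.
Set Implicit Arguments. Unset Strict Implicit. Unset Printing Implicit Defensive.
Import Order.TTheory GRing.Theory Num.Theory numFieldNormedType.Exports.
Local Open Scope classical_set_scope.
Local Open Scope ring_scope.

Definition subordinator (R : realType) (d : measure_display)
  (T : measurableType d) (P : probability T R) (xi : R -> T -> R) : Prop :=
  (forall l, measurable_fun setT (xi l)) /\
  [/\ (forall w, xi 0 w = 0),
      (forall w a b, 0 <= a -> a <= b -> xi a w <= xi b w),
      (forall w (a : R), 0 <= a -> xi l w @[l --> a^'+] --> xi a w),
      (forall s t (B : set R), 0 <= s -> 0 <= t -> measurable B ->
          P [set w | xi (s + t) w - xi s w \in B] = P [set w | xi t w \in B])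
    & (forall (n : nat) (t : nat -> R) (B : nat -> set R),
          0 <= t 0%N -> (forall i, t i <= t i.+1) ->
          (forall i, measurable (B i)) ->
          P (\bigcap_(i in [set k | (k < n)%N])
                [set w | xi (t i.+1) w - xi (t i) w \in B i]) =
          \big[*%E/1%E]_(i < n) P [set w | xi (t i.+1) w - xi (t i) w \in B i])].

Definition laplace_exponent (R : realType) (d : measure_display)
  (T : measurableType d) (P : probability T R) (xi : R -> T -> R)
  (Phi : R -> R) : Prop :=
  forall l s, 0 <= l -> 0 <= s ->
    (\int[P]_w (expR (- (s * xi l w)))%:E = (expR (- (l * Phi s)))%:E)%E.

(* Rv is (a random variable with the law of) the remainder of xi:
   a positive random variable with E[Rv^n] = Phi(1) ... Phi(n), n >= 1. *)
Definition is_remainder (R : realType) (d : measure_display)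
  (T : measurableType d) (P : probability T R) (Phi : R -> R)
  (Rv : T -> R) : Prop :=
  [/\ measurable_fun setT Rv, (forall w, 0 < Rv w)
    & forall n : nat, (0 < n)%N ->
        (\int[P]_w ((Rv w) ^+ n)%:E = (\prod_(1 <= k < n.+1) Phi k%:R)%:E)%E].

(* Main.v *)
(** Write M(r) = E[Rv^(r-1)].  The point is the functional equation
    M(r+1) = Phi(r) M(r) for every real r > 0; only integer moments are given.
    Since 1 / Phi(s) = int_0^oo E[exp(- s xi_l)] dl, the moment recursion
    m_(n+1) = Phi(n+1) m_n says that Rv under P' and Y = Rv exp(- xi_l) under
    the measure Y dP' dP dl have the same moments.  These are O(C^n n!), so the
    two Laplace transforms agree near 0, and then everywhere by steps of fixed
    length; integrating them against lambda^(a-1) gives equal real powers.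
    Hoelder makes M log-convex, which squeezes M(n+r) between
    M(n+1) Phi(n)^(r-1) and (1 + 1/n)^(-1) times it for 0 < r <= 1, as in the
    Bohr-Mollerup theorem; larger r follow from the functional equation. *)

Require Import Defs.
From HB Require Import structures.
From mathcomp Require Import all_boot all_order all_algebra.
From mathcomp Require Import all_classical all_reals all_analysis.
From mathcomp Require Import measurable_realfun exponential_distribution ring lra.
Import Order.TTheory GRing.Theory Num.Theory numFieldNormedType.Exports.
Local Open Scope classical_set_scope.
Local Open Scope ring_scope.

(** * Mellin kernel *)

(** A zero integral would force [f] to vanish almost everywhere; as [f] never vanishes, the whole
    space would be null. *)
Lemma integral_gt0 {R : realType} {d : measure_display}
  {T : measurableType d} (mu : {measure set T -> \bar R}) (f : T -> R) :
  mu setT != 0%E -> measurable_fun setT f -> (forall x, 0 < f x) ->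
  (0 < \int[mu]_x (f x)%:E)%E.
Proof.
move=> mu0 mf f0; rewrite lt_neqAle integral_ge0 ?andbT; last first.
  by move=> x _; rewrite lee_fin ltW.
apply: contra_neq mu0 => int0.
have : (\int[mu]_x `|(f x)%:E|)%E = 0%E.
  by under eq_integral do rewrite gee0_abs ?lee_fin ?ltW//.
move/(ae_eq_integral_abs mu measurableT); case; first exact/measurable_EFinP.
move=> N [mN N0 sub]; apply/eqP; rewrite -measure_le0 -N0.
rewrite le_measure ?inE// => x _; apply: sub => /= /(_ I) [] fx0.
by have := f0 x; rewrite fx0 ltxx.
Qed.

Lemma integral_probability1 {R : realType} {d : measure_display}
  {T : measurableType d} (P : probability T R) : (\int[P]_w 1%:E = 1%:E)%E.
Proof.
rewrite (integral_cst P measurableT 1).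
by rewrite [X in (_ * X)%E](@probability_setT _ _ _ P) mule1.
Qed.

(** Up to the factor [a], the integrand is the density of an exponential law, whose total mass is
    1. *)
Lemma integral_expR_half_line {R : realType} (a : R) : 0 < a ->
  (\int[@lebesgue_measure R]_(t in `[0%R, +oo[) (expR (- (t * a)))%:E = a^-1%:E)%E.
Proof.
move=> a0; rewrite integral_mkcond.
under eq_integral => t _.
  rewrite (_ : _ t = a^-1%:E * (exponential_pdf a t)%:E)%E; last first.
    rewrite /exponential_pdf !patchE; case: ifP => _; last by rewrite mule0.
    by rewrite -EFinM mulKf ?gt_eqF// mulNr mulrC.
  over.
rewrite ge0_integralZl_EFin//=.
- by rewrite integral_exponential_pdf// mule1.
- by move=> t _; rewrite lee_fin; apply: exponential_pdf_ge0; exact: ltW.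
- by apply/measurable_EFinP; exact: measurable_exponential_pdf.
- by rewrite invr_ge0 ltW.
Qed.

(* The integrand of [int_0^oo l^(a-1) e^(-lx) dl] after [l = e^t]: scaling in [x]
   becomes a translation in [t]. *)
Definition mellin_kernel {R : realType} (a x t : R) : R :=
  expR (a * t) * expR (- (x * expR t)).

Lemma mellin_kernel_gt0 {R : realType} (a x t : R) : 0 < mellin_kernel a x t.
Proof. by rewrite mulr_gt0 ?expR_gt0. Qed.

Lemma measurable_mellin_kernel {R : realType} (a x : R) :
  measurable_fun setT (mellin_kernel a x).
Proof.
apply: measurable_funM.
  by apply: measurableT_comp => //; exact: measurable_funM.
apply: measurableT_comp => //; apply: measurableT_comp => //.
exact: measurable_funM.
Qed.

Lemma continuous_mellin_kernel {R : realType} (a x : R) :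
  continuous (mellin_kernel a x).
Proof.
move=> t; apply: cvgM.
  apply: (@continuous_comp _ _ _ (fun t => a * t) expR); last exact: continuous_expR.
  by apply: cvgM => //; exact: cvg_cst.
apply: (@continuous_comp _ _ _ (fun t => - (x * expR t)) expR);
  last exact: continuous_expR.
apply: cvgN; apply: cvgM; first exact: cvg_cst.
exact: continuous_expR.
Qed.

Lemma mellin_kernel_scale {R : realType} (a x t : R) : 0 < x ->
  mellin_kernel a x t = x `^ (- a) * mellin_kernel a 1 (t + ln x).
Proof.
move=> x0; rewrite /mellin_kernel /powR gt_eqF// mulrA -[X in _ = X * _]expRD mul1r.
rewrite [expR (t + ln x)]expRD lnK ?posrE// (mulrC x); congr (expR _ * _).
by ring.
Qed.

(** Translation by [ln x] preserves Lebesgue measure. The integral on the right is Gamma(a), so [x]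
    to the power [- a] becomes a mixture of the exponentials exp(- x e^t). *)
Lemma integral_mellin_kernel {R : realType} (a x : R) : 0 < x ->
  (\int[@lebesgue_measure R]_t (mellin_kernel a x t)%:E =
   (x `^ (- a))%:E * \int[@lebesgue_measure R]_t (mellin_kernel a 1 t)%:E)%E.
Proof.
move=> x0.
pose F (t : R) := t + ln x.
have dF : derive1 F = cst 1.
  by apply/funext => t; rewrite derive1E /F deriveD// derive_id derive_cst addr0.
rewrite [in RHS](@increasing_ge0_integration_by_substitutionT _ F).
- rewrite -ge0_integralZl_EFin//=.
  + apply: eq_integral => t _; rewrite -EFinM mellin_kernel_scale//.
    by rewrite /= dF mulr1.
  + by move=> t _; rewrite lee_fin dF mulr1 ltW// mellin_kernel_gt0.
  + apply/measurable_EFinP; rewrite dF; apply: measurable_funM => //.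
    apply: measurableT_comp; first exact: measurable_mellin_kernel.
    exact: measurable_funD.
  + exact: powR_ge0.
- by move=> s t; rewrite /F ltrD2r.
- by rewrite dF; exact: cst_continuous.
- by rewrite dF; exact: is_cvg_cst.
- by rewrite dF; exact: is_cvg_cst.
- by move=> t; rewrite /F; exact: derivableD.
- apply/cvgrNyPle => A; near=> t; rewrite /F -lerBrDr.
  by near: t; apply: nbhs_ninfty_le; rewrite num_real.
- apply/cvgryPge => A; near=> t; rewrite /F -lerBlDr.
  by near: t; apply: nbhs_pinfty_ge; rewrite num_real.
- exact: continuous_mellin_kernel.
- by move=> t; rewrite ltW// mellin_kernel_gt0.
Unshelve. all: by end_near. Qed.

(** Finiteness of Gamma(a): the line is split at 0 and the kernel is dominated by a decaying
    exponential on each side. *)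
Lemma integral_mellin_kernel1_fin {R : realType} (a : R) : 0 < a ->
  (\int[@lebesgue_measure R]_t (mellin_kernel a 1 t)%:E < +oo)%E.
Proof.
move=> a0.
have mk D : measurable D -> measurable_fun D (EFin \o mellin_kernel a 1).
  move=> mD; apply/measurable_EFinP; apply: measurable_funTS.
  exact: measurable_mellin_kernel.
have me D b : measurable D -> measurable_fun D (fun t : R => (expR (- (t * b)))%:E).
  move=> mD; apply/measurable_EFinP; apply: measurable_funTS.
  apply: measurableT_comp => //; by apply: measurableT_comp => //; exact: measurable_funM.
have k0 t : (0%E <= (mellin_kernel a 1 t)%:E)%E by rewrite lee_fin ltW ?mellin_kernel_gt0.
rewrite -(setUv `[0%R, +oo[%classic) ge0_integral_setU//=; last 3 first.
- exact: measurableC.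
- by rewrite setUv; exact: mk.
- exact/disj_setPCl.
apply: lte_add_pinfty.
  (* The tangent to exp at ln(2a) gives e^t >= 2a (1 + t - ln(2a)), hence a t - e^t <= - a t + 2a
     (ln(2a) - 1). *)
  pose C := expR (a *+ 2 * (ln (a *+ 2) - 1)).
  have a20 : 0 < a *+ 2 by rewrite mulrn_wgt0.
  apply: (@le_lt_trans _ _ (\int[@lebesgue_measure R]_(t in `[0%R, +oo[)
      (C%:E * (expR (- (t * a)))%:E))%E).
    apply: ge0_le_integral => //.
    - exact: mk.
    - by apply: measurable_funeM; exact: me.
    - move=> t _; rewrite -EFinM lee_fin /C /mellin_kernel -!expRD ler_expR mul1r.
      have := expR_ge1Dx (t - ln (a *+ 2)); rewrite expRB lnK ?posrE//.
      rewrite ler_pdivlMr// => H; lra.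
  rewrite ge0_integralZl_EFin//; last 2 first.
    exact: me.
    exact: expR_ge0.
  by rewrite integral_expR_half_line// -EFinM ltry.
(* For negative [t] the factor exp(- e^t) is at most 1, and the remaining e^(a t) is reflected onto
   the positive half line. *)
apply: (@le_lt_trans _ _ (\int[@lebesgue_measure R]_(t in `]-oo, 0%R])
    (expR (- (- t * a)))%:E)%E).
  apply: (@le_trans _ _ (\int[@lebesgue_measure R]_(t in `]-oo, 0%R])
      (mellin_kernel a 1 t)%:E)%E).
    apply: ge0_subset_integral => //.
    - exact: measurableC.
    - exact: mk.
    - by move=> t /=; rewrite !in_itv/= andbT => /negP; rewrite -ltNge => /ltW.
  apply: ge0_le_integral => //.
  - exact: mk.
  - apply/measurable_EFinP; apply: measurable_funTS; apply: measurableT_comp => //.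
    apply: measurableT_comp => //; apply: measurable_funM => //.
  - move=> t _; rewrite lee_fin /mellin_kernel -!expRD ler_expR mul1r.
    by rewrite mulNr opprK mulrC gerDl oppr_le0 expR_ge0.
rewrite -(@ge0_integration_by_substitution0 R (fun t => (expR (- (t * a)))%:E)).
- by rewrite integral_expR_half_line// ltry.
- exact: me.
- by move=> t; rewrite lee_fin expR_ge0.
Qed.

(** * Laplace transforms and moments *)

Definition exp_taylor {R : realType} (N : nat) (y : R) : R :=
  \sum_(j < N) (- y) ^+ j / j`!%:R.

Lemma is_derive_exp_taylor {R : realType} (N : nat) (y : R) :
  is_derive y 1 (exp_taylor N.+1) (- exp_taylor N y).
Proof.
have -> : @exp_taylor R N.+1 =
    \sum_(j < N.+1) (fun y : R => (- y) ^+ j / j`!%:R).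
  by apply/funext => z; rewrite fct_sumE.
have H (j : 'I_N.+1) : is_derive y 1 (fun y : R => (- y) ^+ j / j`!%:R)
    (- (j%:R * (- y) ^+ j.-1 / j`!%:R)).
  have -> : (fun y : R => (- y) ^+ j / j`!%:R) = (j`!%:R)^-1 *: ((-%R : R -> R) ^+ j).
    by apply/funext => z; rewrite /GRing.scale/= exprfctE mulrC.
  apply: is_derive_eq; rewrite /GRing.scale/=.
  by ring.
apply: (is_derive_eq (is_derive_sum H)).
rewrite big_ord_recl/= !mul0r oppr0 add0r /exp_taylor -sumrN.
apply: eq_bigr => j _; rewrite /bump add1n/= factS natrM invfM; congr (- _).
rewrite -mulrA mulrC -!mulrA; congr (_ * _).
by rewrite mulrCA mulVf ?mulr1// pnatr_eq0.
Qed.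

(** Induction on [N]: the signed error of order N+1 vanishes at 0 and its derivative is the signed
    error of order N, so it is nondecreasing. *)
Lemma exp_taylor_alternating {R : realType} (N : nat) (y : R) : 0 <= y ->
  0 <= (-1) ^+ N * (expR (- y) - exp_taylor N y).
Proof.
elim: N y => [|N IH] y y0.
  by rewrite /exp_taylor big_ord0 subr0 expr0 mul1r expR_ge0.
pose f (z : R) : R := (-1) ^+ N.+1 * (expR (- z) - exp_taylor N.+1 z).
have df (z : R) : is_derive z 1 f ((-1) ^+ N * (expR (- z) - exp_taylor N z)).
  have H := is_derive_exp_taylor N z.
  apply: is_derive_eq.
  by rewrite /GRing.scale/= exprS; ring.
have f0 : f 0 = 0.
  rewrite /f /exp_taylor oppr0 expR0 big_ord_recl big1 ?addr0.
    by rewrite expr0 fact0 divr1 subrr mulr0.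
  by move=> i _; rewrite /= /bump add1n expr0n/= mul0r.
rewrite -[leLHS]f0; apply: (@ger0_derive1_ndecr R f 0 y) => //.
- by move=> z; rewrite in_itv/= => /andP[/ltW z0 _]; rewrite derive1E derive_val IH.
- apply: continuous_subspaceT => z.
  by apply: differentiable_continuous; apply/derivable1_diffP.
Qed.

(** Errors of consecutive orders have opposite signs, so the error is at most the first omitted
    term. *)
Lemma exp_taylor_remainder {R : realType} (N : nat) (y : R) : 0 <= y ->
  `|expR (- y) - exp_taylor N y| <= y ^+ N / N`!%:R.
Proof.
move=> y0; have := exp_taylor_alternating N y y0.
have := exp_taylor_alternating N.+1 y y0.
rewrite /exp_taylor big_ord_recr/= -/(exp_taylor N y) (exprNn y) exprS.
set D := expR (- y) - exp_taylor N y => H1 H2.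
have s2 : (-1) ^+ N * (-1) ^+ N = 1 :> R by rewrite -expr2 sqrr_sign.
have -> : `|D| = (-1) ^+ N * D.
  by rewrite -[RHS]ger0_norm// normrM normrX normrN1 expr1n mul1r.
rewrite -subr_ge0; apply: le_trans H1 _; rewrite /D.
set e := (-1) ^+ N in s2 *; rewrite le_eqVlt; apply/orP; left; apply/eqP.
(* [ring] cannot use the relation e^2 = 1, so the square is inserted by hand. *)
have -> : y ^+ N / N`!%:R = e * e * (y ^+ N / N`!%:R) by rewrite s2 mul1r.
by ring.
Qed.

Section laplace_taylor.
Context {d : measure_display} {T : measurableType d} {R : realType}.
Variables (mu : {measure set T -> \bar R}) (p X : T -> R) (m : nat -> R).
Hypotheses (mp : measurable_fun setT p) (mX : measurable_fun setT X).
Hypotheses (p0 : forall x, 0 <= p x) (X0 : forall x, 0 <= X x).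
Hypothesis momentE : forall k, (\int[mu]_x (p x * X x ^+ k)%:E = (m k)%:E)%E.

Lemma measurable_weighted_expR (h : R) (k : nat) :
  measurable_fun setT (fun x => p x * expR (- (h * X x)) * X x ^+ k).
Proof.
apply: measurable_funM; last exact: measurable_funX.
apply: measurable_funM => //; apply: measurableT_comp => //.
by apply: measurableT_comp => //; exact: measurable_funM.
Qed.

Lemma integrable_moment (k : nat) :
  mu.-integrable setT (EFin \o (fun x => p x * X x ^+ k)).
Proof.
apply/integrableP; split.
  apply/measurable_EFinP; apply: measurable_funM => //.
  exact: measurable_funX.
under eq_integral do rewrite /= ger0_norm ?mulr_ge0 ?exprn_ge0//.
by rewrite momentE ltry.
Qed.

Lemma integrable_weighted_expR (h : R) (k : nat) : 0 <= h ->
  mu.-integrable setT (EFin \o (fun x => p x * expR (- (h * X x)) * X x ^+ k)).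
Proof.
move=> h0; apply: le_integrable (integrable_moment k) => //.
  by apply/measurable_EFinP; exact: measurable_weighted_expR.
move=> x _; rewrite lee_fin /= !ger0_norm ?mulr_ge0 ?exprn_ge0 ?expR_ge0//.
by rewrite ler_wpM2r ?exprn_ge0// ler_piMr// expR_le1 oppr_le0 mulr_ge0.
Qed.

Lemma integral_weighted_exp_taylor (h : R) (N : nat) :
  mu.-integrable setT (EFin \o (fun x => p x * exp_taylor N (h * X x))) /\
  \int[mu]_x (p x * exp_taylor N (h * X x)) =
  \sum_(j < N) (- h) ^+ j / j`!%:R * m j.
Proof.
elim: N => [|N [IH1 IH2]].
  have E : (fun x => p x * exp_taylor 0 (h * X x)) = cst 0.
    by apply/funext => x; rewrite /exp_taylor big_ord0 mulr0.
  rewrite E big_ord0; split; first exact: integrable0.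
  by rewrite /Rintegral integral0.
have E : (fun x => p x * exp_taylor N.+1 (h * X x)) =
   (fun x => p x * exp_taylor N (h * X x) +
     (- h) ^+ N / N`!%:R * (p x * X x ^+ N)).
  apply/funext => x; rewrite /exp_taylor big_ord_recr/= mulrDr; congr (_ + _).
  by rewrite -mulNr exprMn; ring.
have I : mu.-integrable setT (EFin \o
    (fun x => (- h) ^+ N / N`!%:R * (p x * X x ^+ N))).
  exact: (integrableZl measurableT _ (integrable_moment N)).
rewrite E; split.
  exact: (integrableD _ IH1 I).
rewrite RintegralD// IH2 big_ord_recr/= RintegralZl//; last exact: integrable_moment.
by rewrite [X in _ + _ * X]/Rintegral momentE.
Qed.

(** The pointwise Taylor bound, integrated. The weight [p] is kept general because it is later
    multiplied by powers of [X] and by exponentials exp(- h X). *)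
Lemma laplace_taylor (h : R) (N : nat) : 0 <= h ->
  `|\int[mu]_x (p x * expR (- (h * X x))) - \sum_(j < N) (- h) ^+ j / j`!%:R * m j|
   <= h ^+ N / N`!%:R * m N.
Proof.
move=> h0; have [I E] := integral_weighted_exp_taylor h N.
have Ie : mu.-integrable setT (EFin \o (fun x => p x * expR (- (h * X x)))).
  apply: (eq_integrable measurableT _ _ _ (integrable_weighted_expR h 0%N h0)) => //.
  by move=> x _; rewrite /= expr0 mulr1.
rewrite -E -RintegralB//.
have ID := integrableB measurableT Ie I.
apply: le_trans (le_normr_Rintegral measurableT ID) _.
have Im : mu.-integrable setT (EFin \o (fun x => h ^+ N / N`!%:R * (p x * X x ^+ N))).
  exact: (integrableZl measurableT _ (integrable_moment N)).
have -> : h ^+ N / N`!%:R * m N = \int[mu]_x (h ^+ N / N`!%:R * (p x * X x ^+ N)).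
  rewrite RintegralZl//; last exact: integrable_moment.
  by rewrite /Rintegral momentE.
apply: le_Rintegral => //.
  exact: integrable_norm.
move=> x _; rewrite -mulrBr normrM ger0_norm//.
rewrite [leRHS](_ : _ = p x * ((h * X x) ^+ N / N`!%:R)); last first.
  by rewrite exprMn; ring.
by rewrite ler_wpM2l// exp_taylor_remainder// mulr_ge0.
Qed.

End laplace_taylor.

Lemma eq_geometric {R : realType} (a b K : R) :
  (forall N, `|a - b| <= K * 2^-1 ^+ N) -> a = b.
Proof.
move=> H; apply/eqP; rewrite -subr_eq0 -normr_le0 leNgt; apply/negP => ab0.
(* With this [n], 2^n >= n + 1 > K / |a - b|, which contradicts the bound at [n]. *)
pose n := Num.truncn (K / `|a - b|).
have := H n; apply/negP; rewrite -ltNge exprVn.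
rewrite ltr_pdivrMr ?exprn_gt0// -ltr_pdivrMl// mulrC.
apply: lt_le_trans (truncnS_gt _) _.
by rewrite -natrX ler_nat ltn_expl.
Qed.

(** The binomial coefficient is one term of the expansion of (1 + 1)^(k+j). This shows that shifting
    a moment sequence of factorial growth at most doubles its rate. *)
Lemma fact_add_le (k j : nat) : ((k + j)`! <= 2 ^ (k + j) * k`! * j`!)%N.
Proof.
rewrite -(@bin_fact (k + j) k) ?leq_addr// addKn mulnA leq_mul2r.
rewrite leq_mul2r; apply/orP; right; apply/orP; right.
have := expnDn 1 1 (k + j); rewrite addn1 => ->.
rewrite (bigD1 (inord k))//= inordK ?ltnS ?leq_addr// !exp1n !muln1.
exact: leq_addr.
Qed.

(** * Moment determinacy under factorial growth *)

Section determinacy.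
Context {d1 d2 : measure_display} {T1 : measurableType d1}
  {T2 : measurableType d2} {R : realType}.
Variables (mu : {measure set T1 -> \bar R}) (nu : {measure set T2 -> \bar R}).
Variables (X : T1 -> R) (Y : T2 -> R) (C : R).
Hypotheses (mX : measurable_fun setT X) (mY : measurable_fun setT Y).
Hypotheses (X0 : forall x, 0 <= X x) (Y0 : forall y, 0 <= Y y) (C0 : 0 < C).

(** The rate [c] is a parameter because it limits the admissible Laplace arguments; [K] is only a
    scale and stays existential. *)
Definition same_moments (c : R) (p : T1 -> R) (q : T2 -> R) (m : nat -> R) :=
  [/\ measurable_fun setT p /\ measurable_fun setT q,
      (forall x, 0 <= p x) /\ (forall y, 0 <= q y),
      forall k, (\int[mu]_x (p x * X x ^+ k)%:E = (m k)%:E)%E,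
      forall k, (\int[nu]_y (q y * Y y ^+ k)%:E = (m k)%:E)%E
    & exists K, forall k, m k <= K * c ^+ k * k`!%:R].

(** Both transforms lie within K (h c)^N <= K 2^(-N) of the same Taylor sum: the factorial in the
    moment bound cancels the one in the Taylor remainder. *)
Lemma same_moments_laplace_small (c h : R) p q m :
  0 < c -> 0 <= h -> 2 * h * c <= 1 -> same_moments c p q m ->
  (\int[mu]_x (p x * expR (- (h * X x)))%:E =
   \int[nu]_y (q y * expR (- (h * Y y)))%:E)%E.
Proof.
move=> c0 h0 hc [[mp mq] [p0 q0] pm qm [K mK]].
have fp := integrable_weighted_expR mu p X m mp mX p0 X0 pm h 0%N h0.
have fq := integrable_weighted_expR nu q Y m mq mY q0 Y0 qm h 0%N h0.
rewrite -[LHS]fineK; last first.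
  have := integrable_fin_num measurableT fp.
  by under eq_integral do rewrite /= mulr1.
rewrite -[RHS]fineK; last first.
  have := integrable_fin_num measurableT fq.
  by under eq_integral do rewrite /= mulr1.
congr EFin; apply: (eq_geometric _ _ (2 * K)) => N.
pose s := \sum_(j < N) (- h) ^+ j / j`!%:R * m j.
have H1 := laplace_taylor mu p X m mp mX p0 X0 pm h N h0.
have H2 := laplace_taylor nu q Y m mq mY q0 Y0 qm h N h0.
apply: (le_trans (ler_distD s _ _)).
rewrite [X in _ + X]distrC -mulrA mulr_natl mulr2n.
suff H : h ^+ N / N`!%:R * m N <= K * 2^-1 ^+ N.
  by apply: lerD; [apply: le_trans H1 _|apply: le_trans H2 _].
have K0 : 0 <= K.
  apply: le_trans (_ : m 0%N <= _); last by have := mK 0%N; rewrite fact0 expr0 !mulr1.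
  by rewrite -lee_fin -pm integral_ge0// => x _; rewrite lee_fin mulr_ge0.
apply: (@le_trans _ _ (h ^+ N / N`!%:R * (K * c ^+ N * N`!%:R))).
  by apply: ler_wpM2l => //; rewrite divr_ge0// exprn_ge0.
have -> : h ^+ N / N`!%:R * (K * c ^+ N * N`!%:R) = K * (h * c) ^+ N.
  by rewrite exprMn; field; rewrite pnatr_eq0 -lt0n fact_gt0.
apply: ler_wpM2l => //; apply: lerXn2r; rewrite ?nnegrE ?mulr_ge0 ?invr_ge0 ?(ltW c0)//.
lra.
Qed.

(* The moments after the step are dominated by the old ones, so [C], and with it
   the admissible step length, stays the same along the iteration. *)
Lemma same_moments_laplace_step (h : R) p q m :
  0 <= h -> 4 * h * C <= 1 -> same_moments C p q m ->
  exists m', same_moments C (fun x => p x * expR (- (h * X x)))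
    (fun y => q y * expR (- (h * Y y))) m'.
Proof.
move=> h0 hC [[mp mq] [p0 q0] pm qm [K mK]].
pose p' x := p x * expR (- (h * X x)); pose q' y := q y * expR (- (h * Y y)).
have K0 : 0 <= K.
  apply: le_trans (_ : m 0%N <= _); last by have := mK 0%N; rewrite fact0 expr0 !mulr1.
  by rewrite -lee_fin -pm integral_ge0// => x _; rewrite lee_fin mulr_ge0.
have E k : (\int[mu]_x (p' x * X x ^+ k)%:E = \int[nu]_y (q' y * Y y ^+ k)%:E)%E.
  (* Weighting by the k-th power shifts the moments by [k] and doubles the rate, whence the 4 in the
     bound on [h]. The small-argument case for this weight gives the k-th moments after tilting. *)
  have S : same_moments (2 * C) (fun x => p x * X x ^+ k) (fun y => q y * Y y ^+ k)
      (fun j => m (k + j)%N).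
    split.
    - by split; apply: measurable_funM => //; exact: measurable_funX.
    - by split=> z; rewrite mulr_ge0 ?exprn_ge0.
    - by move=> j; rewrite -pm; apply: eq_integral => x _; rewrite exprD mulrA.
    - by move=> j; rewrite -qm; apply: eq_integral => x _; rewrite exprD mulrA.
    - exists (K * (2 * C) ^+ k * k`!%:R) => j; apply: le_trans (mK _) _.
      apply: (@le_trans _ _ (K * C ^+ (k + j) * (2 ^ (k + j) * k`! * j`!)%:R)).
        rewrite ler_wpM2l ?ler_nat ?fact_add_le// mulr_ge0// exprn_ge0//.
        exact: ltW.
      rewrite !natrM natrX !exprD !exprMn le_eqVlt.
      by apply/orP; left; apply/eqP; ring.
  have hC' : 2 * h * (2 * C) <= 1 by apply: le_trans hC; lra.
  have := same_moments_laplace_small (2 * C) h _ _ _ _ h0 hC' S.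
  rewrite mulr_gt0// => /(_ isT) H.
  transitivity (\int[mu]_x (p x * X x ^+ k * expR (- (h * X x)))%:E)%E.
    by apply: eq_integral => x _; rewrite /p' mulrAC.
  by rewrite H; apply: eq_integral => x _; rewrite /q' mulrAC.
have F k : (\int[mu]_x (p' x * X x ^+ k)%:E)%E \is a fin_num.
  exact: integrable_fin_num (integrable_weighted_expR mu p X m mp mX p0 X0 pm h k h0).
exists (fun k => fine (\int[mu]_x (p' x * X x ^+ k)%:E)); split.
- split; apply: measurable_funM => //; apply: measurableT_comp => //;
    by apply: measurableT_comp => //; exact: measurable_funM.
- by split=> z; rewrite mulr_ge0 ?expR_ge0.
- by move=> k; rewrite fineK.
- by move=> k; rewrite fineK// E.
- exists K => k; apply: le_trans (mK k); rewrite -lee_fin fineK// -pm.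
  apply: ge0_le_integral => //.
  + by move=> x _; rewrite lee_fin !mulr_ge0 ?expR_ge0 ?exprn_ge0.
  + by apply/measurable_EFinP; exact: measurable_weighted_expR.
  + by apply/measurable_EFinP; apply: measurable_funM => //; exact: measurable_funX.
  + move=> x _; rewrite lee_fin ler_wpM2r ?exprn_ge0// ler_piMr//.
    by rewrite expR_le1 oppr_le0 mulr_ge0.
Qed.

Lemma same_moments_laplace (l : R) p q m : 0 <= l -> same_moments C p q m ->
  exists m', same_moments C (fun x => p x * expR (- (l * X x)))
    (fun y => q y * expR (- (l * Y y))) m'.
Proof.
(* Any [l] is reached in [N] equal steps, with [N] above 4 l C so that each step is admissible. *)
move=> l0 S; pose N := (Num.truncn (4 * l * C)).+1; pose h := l / N%:R.
have N0 : 0 < N%:R :> R by rewrite ltr0n.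
have h0 : 0 <= h by rewrite divr_ge0// ltW.
have hC : 4 * h * C <= 1.
  have -> : 4 * h * C = (4 * l * C) / N%:R by rewrite /h; ring.
  by rewrite ler_pdivrMr// mul1r ltW// truncnS_gt.
suff H n : exists m', same_moments C (fun x => p x * expR (- (n%:R * h * X x)))
    (fun y => q y * expR (- (n%:R * h * Y y))) m'.
  by have := H N; rewrite mulrC divfK// gt_eqF.
elim: n => [|n [m' S']].
  exists m; move: S; congr same_moments; apply/funext => z;
    by rewrite mul0r mul0r oppr0 expR0 mulr1.
have [m'' S''] := same_moments_laplace_step _ _ _ _ h0 hC S'.
exists m''; move: S''; congr same_moments; apply/funext => z;
  by rewrite -mulrA -expRD -natr1; congr (_ * expR _); ring.
Qed.

End determinacy.

(** Tonelli for [p x * mellin_kernel a (X x) t]: integrating first in [t] gives Gamma(a) times the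
    power, integrating first in [x] gives the Laplace transform at e^t. Both sides may be
    infinite. *)
Lemma integral_powR_laplace {R : realType} {d : measure_display}
  {T : measurableType d} (mu : {sigma_finite_measure set T -> \bar R})
  (p X : T -> R) (a : R) :
  measurable_fun setT p -> measurable_fun setT X ->
  (forall x, 0 <= p x) -> (forall x, 0 < X x) -> 0 < a ->
  (\int[@lebesgue_measure R]_t (mellin_kernel a 1 t)%:E *
     \int[mu]_x (p x * X x `^ (- a))%:E =
   \int[@lebesgue_measure R]_t ((expR (a * t))%:E *
     \int[mu]_x (p x * expR (- (expR t * X x)))%:E))%E.
Proof.
move=> mp mX p0 X0 a0.
pose f (z : T * R) := (p z.1 * mellin_kernel a (X z.1) z.2)%:E.
have f0 z : (0 <= f z)%E by rewrite lee_fin mulr_ge0// ltW// mellin_kernel_gt0.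
have mf : measurable_fun setT f.
  apply/measurable_EFinP; apply: measurable_funM; first exact: measurableT_comp.
  apply: measurable_funM.
    by apply: measurableT_comp => //; exact: measurable_funM.
  apply: measurableT_comp => //; apply: measurableT_comp => //.
  by apply: measurable_funM; exact: measurableT_comp.
have := @fubini_tonelli _ _ T (measurableTypeR R) R mu lebesgue_measure f mf f0.
rewrite /f/= => H.
rewrite -ge0_integralZl//=; last 3 first.
- apply/measurable_EFinP; apply: measurable_funM => //.
  exact: (measurableT_comp (measurable_powR (- a)) mX).
- by move=> x _; rewrite lee_fin mulr_ge0// powR_ge0.
- by apply: integral_ge0 => t _; rewrite lee_fin ltW// mellin_kernel_gt0.
transitivity (\int[mu]_x \int[@lebesgue_measure R]_t
    (p x * mellin_kernel a (X x) t)%:E)%E.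
  apply: eq_integral => x _.
  under [RHS]eq_integral do rewrite EFinM.
  rewrite ge0_integralZl_EFin//; last 2 first.
  - by move=> t _; rewrite lee_fin ltW// mellin_kernel_gt0.
  - by apply/measurable_EFinP; exact: measurable_mellin_kernel.
  rewrite (integral_mellin_kernel a (X x))// EFinM muleCA; congr (_ * _)%E.
  exact: muleC.
rewrite {}H; apply: eq_integral => t _.
rewrite -ge0_integralZl_EFin ?expR_ge0//=.
- by apply: eq_integral => x _; rewrite -EFinM /mellin_kernel mulrCA (mulrC (X x)).
- by move=> x _; rewrite lee_fin mulr_ge0 ?expR_ge0.
- apply/measurable_EFinP; apply: measurable_funM => //.
  by apply: measurableT_comp => //; apply: measurableT_comp => //; exact: measurable_funM.
Qed.

(** The Mellin formula yields negative powers only; the extra factor of order [n] makes every real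
    exponent n - a available. *)
Lemma same_moments_powR {R : realType} {d1 d2 : measure_display}
  {T1 : measurableType d1} {T2 : measurableType d2}
  (mu : {sigma_finite_measure set T1 -> \bar R})
  (nu : {sigma_finite_measure set T2 -> \bar R})
  (X : T1 -> R) (Y : T2 -> R) (C : R) p q m (a : R) (n : nat) :
  measurable_fun setT X -> measurable_fun setT Y ->
  (forall x, 0 < X x) -> (forall y, 0 < Y y) -> 0 < C -> 0 < a ->
  same_moments mu nu X Y C p q m ->
  (\int[mu]_x (p x * X x ^+ n * X x `^ (- a))%:E =
   \int[nu]_y (q y * Y y ^+ n * Y y `^ (- a))%:E)%E.
Proof.
move=> mX mY X0 Y0 C0 a0 S; have [[mp mq] [p0 q0] _ _ _] := S.
have c0 : (0 < \int[@lebesgue_measure R]_t (mellin_kernel a 1 t)%:E)%E.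
  apply: integral_gt0.
  - have E := @lebesgue_measure_itv R `]-oo, +oo[; rewrite set_itvNyy in E.
    by apply/negP => /eqP; rewrite [LHS]E.
  - exact: measurable_mellin_kernel.
  - by move=> t; exact: mellin_kernel_gt0.
have cy := integral_mellin_kernel1_fin _ a0.
set c := (X in (X < +oo)%E) in cy c0.
have cfin : c \is a fin_num by rewrite gt0_fin_numE.
have mX' : measurable_fun setT (fun x => p x * X x ^+ n).
  by apply: measurable_funM => //; exact: measurable_funX.
have mY' : measurable_fun setT (fun y => q y * Y y ^+ n).
  by apply: measurable_funM => //; exact: measurable_funX.
have X'0 x : 0 <= p x * X x ^+ n by rewrite mulr_ge0// exprn_ge0// ltW.
have Y'0 y : 0 <= q y * Y y ^+ n by rewrite mulr_ge0// exprn_ge0// ltW.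
(* Gamma(a) is finite and positive, so it cancels even when [z] is infinite. *)
have cK z : ((fine c)^-1%:E * (c * z) = z)%E.
  by rewrite -{2}(fineK cfin) muleA -EFinM mulVf ?mul1e// gt_eqF// fine_gt0// c0.
rewrite -[LHS]cK -[RHS]cK; congr (_ * _)%E.
rewrite !integral_powR_laplace//; apply: eq_integral => t _; congr (_ * _)%E.
(* The Laplace transform of the weight p X^n at e^t is the n-th moment of [p] tilted by exp(- e^t
   X). *)
have [m' [_ _ E1 E2 _]] := same_moments_laplace mu nu X Y C mX mY
  (fun x => ltW (X0 x)) (fun y => ltW (Y0 y)) C0 (expR t) p q m (expR_ge0 t) S.
transitivity (m' n)%:E; [rewrite -E1|rewrite -E2];
  by apply: eq_integral => z _; rewrite mulrAC.
Qed.

(** * Laplace exponents *)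

(** With [g] the geometric mean, z/g >= 1 + ln(z/g) for z = x and z = y; in the weighted sum the
    logarithms cancel. *)
Lemma weighted_AMGM {R : realType} (x y t : R) : 0 < x -> 0 < y -> 0 <= t <= 1 ->
  x `^ t * y `^ (1 - t) <= t * x + (1 - t) * y.
Proof.
move=> x0 y0 /andP[t0 t1].
set g := x `^ t * y `^ (1 - t).
have g0 : 0 < g by rewrite mulr_gt0 ?powR_gt0.
have lng : ln g = t * ln x + (1 - t) * ln y.
  by rewrite lnM ?posrE ?powR_gt0// !ln_powR.
have H z : 0 < z -> 1 + (ln z - ln g) <= z / g.
  by move=> z0; apply: le_trans (expR_ge1Dx _) _; rewrite expRB !lnK.
rewrite -(ler_pM2r (_ : 0 < g^-1)) ?invr_gt0// divff ?gt_eqF// mulrDl -!mulrA.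
apply: le_trans (lerD (ler_wpM2l t0 (H _ x0)) (ler_wpM2l _ (H _ y0))).
  by rewrite le_eqVlt lng; apply/orP; left; apply/eqP; ring.
by rewrite subr_ge0.
Qed.

(** Hoelder's inequality with exponents 1/t and 1/(1-t): pointwise AM-GM for the normalised
    functions U/A and V/B, then integration, where the weights add up to 1. *)
Lemma integral_interpolation {R : realType} {d : measure_display}
  {T : measurableType d} (mu : {measure set T -> \bar R}) (U V : T -> R) (A B t : R) :
  measurable_fun setT U -> measurable_fun setT V ->
  (forall x, 0 < U x) -> (forall x, 0 < V x) -> 0 < A -> 0 < B -> 0 <= t <= 1 ->
  (\int[mu]_x (U x)%:E = A%:E)%E -> (\int[mu]_x (V x)%:E = B%:E)%E ->
  (\int[mu]_x (U x `^ t * V x `^ (1 - t))%:E <= (A `^ t * B `^ (1 - t))%:E)%E.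
Proof.
move=> mU mV U0 V0 A0 B0 t01 UA VB; have /andP[t0 t1] := t01.
pose G := A `^ t * B `^ (1 - t).
have G0 : 0 <= G by rewrite mulr_ge0 ?powR_ge0.
have t1' : 0 <= 1 - t by rewrite subr_ge0.
have a0 : 0 <= G * t / A by apply: divr_ge0; [exact: mulr_ge0|exact: ltW].
have b0 : 0 <= G * (1 - t) / B by apply: divr_ge0; [exact: mulr_ge0|exact: ltW].
apply: (@le_trans _ _ (\int[mu]_x ((G * t / A)%:E * (U x)%:E +
    (G * (1 - t) / B)%:E * (V x)%:E))%E).
  apply: ge0_le_integral => //.
  - by move=> x _; rewrite lee_fin mulr_ge0 ?powR_ge0.
  - apply/measurable_EFinP; apply: measurable_funM.
      exact: (measurableT_comp (measurable_powR t) mU).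
    exact: (measurableT_comp (measurable_powR (1 - t)) mV).
  - by apply: emeasurable_funD; apply: measurable_funeM; exact/measurable_EFinP.
  - move=> x _; rewrite -!EFinM -EFinD lee_fin.
    have UAx : 0 < U x / A by rewrite divr_gt0.
    have VBx : 0 < V x / B by rewrite divr_gt0.
    have := weighted_AMGM (U x / A) (V x / B) t UAx VBx t01.
    move=> /(ler_wpM2l G0) H; apply: le_trans (le_trans H _); rewrite le_eqVlt;
      apply/orP; left; apply/eqP; last by ring.
    rewrite /G mulrACA -!powRM ?ltW//.
    by rewrite ![_ * (_ / _)]mulrC !divfK ?gt_eqF.
rewrite ge0_integralD//; last 4 first.
- by move=> x _; rewrite -EFinM lee_fin mulr_ge0// ltW.
- by apply: measurable_funeM; exact/measurable_EFinP.
- by move=> x _; rewrite -EFinM lee_fin mulr_ge0// ltW.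
- by apply: measurable_funeM; exact/measurable_EFinP.
rewrite !ge0_integralZl_EFin//; last 4 first.
- by move=> x _; rewrite lee_fin ltW.
- exact/measurable_EFinP.
- by move=> x _; rewrite lee_fin ltW.
- exact/measurable_EFinP.
rewrite UA VB -!EFinM -EFinD lee_fin !divfK ?gt_eqF//.
by rewrite -mulrDr addrC subrK mulr1.
Qed.

Section laplace_exponent.
Context {R : realType} {d : measure_display} {T : measurableType d}.
Variables (P : probability T R) (xi : R -> T -> R) (Phi : R -> R).
Hypothesis sub : subordinator P xi.
Hypothesis lap : laplace_exponent P xi Phi.
Hypothesis Phi_neq0 : exists s, 0 <= s /\ Phi s != 0.

Let mxi l : measurable_fun setT (xi l).
Proof. by case: sub. Qed.

Let mexpxi s l : measurable_fun setT (fun w => expR (- (s * xi l w))).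
Proof.
apply: measurableT_comp => //; apply: measurableT_comp => //.
exact: measurable_funM.
Qed.

Let xi_ge0 l w : 0 <= l -> 0 <= xi l w.
Proof. by case: sub => _ [xi00 xi_nd _ _ _] l0; rewrite -(xi00 w) xi_nd. Qed.

Lemma laplace_exponent0 : Phi 0 = 0.
Proof.
have := lap 1 0 ler01 (lexx 0).
under eq_integral do rewrite mul0r oppr0 expR0.
rewrite mul1r integral_probability1 => -[] /eqP.
by rewrite eq_sym -[X in _ == X]expR0 => /eqP/expR_inj/eqP; rewrite oppr_eq0 => /eqP.
Qed.

Lemma laplace_exponent_nondecreasing (s t : R) : 0 <= s -> s <= t -> Phi s <= Phi t.
Proof.
move=> s0 st; have t0 := le_trans s0 st.
have := lap 1 s ler01 s0; have := lap 1 t ler01 t0; rewrite !mul1r => Et Es.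
rewrite -lerN2 -ler_expR -lee_fin -Es -Et.
apply: ge0_le_integral => //.
- by apply/measurable_EFinP; apply: mexpxi.
- by apply/measurable_EFinP; exact: mexpxi.
- by move=> w _; rewrite lee_fin ler_expR lerN2 ler_wpM2r// xi_ge0.
Qed.

Lemma laplace_exponent_ge0 (s : R) : 0 <= s -> 0 <= Phi s.
Proof. by move=> s0; rewrite -laplace_exponent0 laplace_exponent_nondecreasing. Qed.

(* Jensen: [s |-> ln E[e^(- s xi_1)] = - Phi s] is convex and vanishes at [0]. *)
Lemma laplace_exponent_star_shaped (s t : R) : 0 < s -> s <= t -> Phi t <= t / s * Phi s.
Proof.
move=> s0 st; have t0 := lt_le_trans s0 st.
have th : 0 <= s / t <= 1.
  apply/andP; split; last by rewrite ler_pdivrMr// mul1r.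
  by rewrite divr_ge0 //; exact: ltW.
have E1 := integral_probability1 P.
have Et := lap 1 t ler01 (ltW t0).
have := integral_interpolation P (fun w => expR (- (t * xi 1 w))) (cst 1)
   (expR (- (1 * Phi t))) 1 (s / t) (mexpxi t 1) (measurable_cst _)
   (fun=> expR_gt0 _) (fun=> ltr01) (expR_gt0 _) ltr01 th Et E1.
under eq_integral do rewrite powR1 mulr1 -expRM.
have -> : (\int[P]_w (expR (- (t * xi 1 w) * (s / t)))%:E = (expR (- (1 * Phi s)))%:E)%E.
  rewrite -(lap 1 s ler01 (ltW s0)); apply: eq_integral => w _; congr (expR _)%:E.
  by field; rewrite gt_eqF.
rewrite lee_fin powR1 mulr1 -expRM ler_expR !mul1r mulNr lerN2 => H.
rewrite mulrAC ler_pdivlMr//.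
by move: H; rewrite mulrA ler_pdivrMr// mulrC (mulrC t).
Qed.

(** A zero at a positive point would spread to the left by monotonicity and to the right by
    star-shapedness, so [Phi] would vanish on the whole half line. *)
Lemma laplace_exponent_gt0 (s : R) : 0 < s -> 0 < Phi s.
Proof.
move=> s0; rewrite lt_neqAle laplace_exponent_ge0 ?ltW// andbT eq_sym.
apply/eqP => Phis0; have [t [t0 /eqP]] := Phi_neq0; apply.
apply/eqP; rewrite eq_le laplace_exponent_ge0// andbT.
have [ts|st] := leP t s; first by rewrite -Phis0 laplace_exponent_nondecreasing.
by have := laplace_exponent_star_shaped s t s0 (ltW st); rewrite Phis0 mulr0.
Qed.

(** Tonelli requires measurability jointly in time and chance. Time is truncated at 0 because the
    path properties are given for nonnegative times. *)
Lemma measurable_subordinator_joint :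
  measurable_fun setT (fun z : T * measurableTypeR R => xi (Num.max 0 z.2) z.1).
Proof.
have [_ [_ xi_nd xi_rc _ _]] := sub.
apply: (measurability _ (RGenInftyO.measurableE R)) => // _ [_ [c ->] <-].
(* For a nondecreasing right-continuous path, xi_a < c exactly when xi_q < c for some rational q >
   a; this makes the preimage a countable union of rectangles. *)
rewrite setTI (_ : _ @^-1` _ = \bigcup_(q : rat)
  (if 0 < ratr q :> R
   then [set w | xi (ratr q) w < c] `*` `]-oo, (ratr q : R)[ else set0)).
  apply: bigcupT_measurable_rat => q; case: ifP => // _.
  apply: measurableX => //=.
  have := mxi (ratr q) measurableT `]-oo, c[%classic (measurable_itv _).
  by rewrite setTI.
apply/seteqP; split => [[w l]/=|[w l]/= [q _]]; rewrite !in_itv/=.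
  set a := Num.max 0 l => xc.
  have a0 : 0 <= a by rewrite le_max lexx.
  have : \forall b \near a^'+, xi b w < c by apply: cvgr_lt xc; exact: xi_rc.
  have gta : \forall b \near a^'+, a < b by exact: nbhs_right_gt.
  move=> H; have [b [ab xbc]] : exists b, a < b /\ xi b w < c.
    near a^'+ => b; exists b; split; near: b => //.
  have [q] := rat_in_itvoo ab; rewrite in_itv/= => /andP[aq qb].
  exists q => //; rewrite (le_lt_trans a0 aq); split=> /=.
    by apply: le_lt_trans xbc; apply: xi_nd; [exact: le_trans (ltW aq)|exact: ltW].
  by rewrite in_itv/= (le_lt_trans _ aq)// le_max lexx orbT.
case: ifP => // q0 [/= xq]; rewrite in_itv/= => lq; apply: le_lt_trans xq.
by apply: xi_nd; [rewrite le_max lexx|rewrite ge_max !ltW].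
Unshelve. all: by end_near. Qed.

End laplace_exponent.

(** * Functional equation of the remainder *)

Section probability_product.
Context {d1 d2 : measure_display} {T1 : measurableType d1} {T2 : measurableType d2}
  {R : realType} (P : probability T1 R) (m : {sigma_finite_measure set T2 -> \bar R}).

Lemma sigma_finite_probability_product : sigma_finite setT (P \x m)%E.
Proof.
have [F FT Foo] := sigma_finiteT m.
exists (fun n => setT `*` F n).
  apply/seteqP; split=> // -[x y] _.
  have : (\bigcup_n F n) y by rewrite -FT.
  by case=> n _ Fny; exists n.
move=> n; have [mF Fn] := Foo n; split; first exact: measurableX.
by rewrite product_measure1E//= [X in (X * _)%E](@probability_setT _ _ _ P) mul1e.
Qed.

(* The canonical sigma-finite structure on product measures only covers products
   of subprobabilities. *)
Definition probability_product := (P \x m)%E.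
HB.instance Definition _ := Measure.on probability_product.
HB.instance Definition _ := Measure_isSigmaFinite.Build _ _ _ probability_product
  sigma_finite_probability_product.
End probability_product.

Section laplace_potential.
Context {R : realType} {d : measure_display} {T : measurableType d}.
Variables (P : probability T R) (xi : R -> T -> R) (Phi : R -> R).
Hypothesis sub : subordinator P xi.
Hypothesis lap : laplace_exponent P xi Phi.
Hypothesis Phi_neq0 : exists s, 0 <= s /\ Phi s != 0.

(** The half line enters as a weight rather than as a restricted measure, so that the product is
    taken with Lebesgue measure on the whole line. *)
Definition nonneg_time (z : T * measurableTypeR R) : R :=
  \1_(`[0%R, +oo[%classic : set R) z.2.

Lemma measurable_nonneg_time : measurable_fun setT nonneg_time.
Proof.
apply: measurableT_comp; last exact: measurable_snd.
exact: measurable_indic.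
Qed.

(** The Laplace transform of the potential measure: by Tonelli the expectation is taken first,
    leaving the integral of exp(- l Phi(s)) over l >= 0. *)
Lemma integral_laplace_potential (s : R) : 0 < s ->
  (\int[probability_product P (@lebesgue_measure R)]_z
     (nonneg_time z * expR (- (s * xi (Num.max 0 z.2) z.1)))%:E = (Phi s)^-1%:E)%E.
Proof.
move=> s0.
pose f (z : T * measurableTypeR R) : \bar R :=
  (nonneg_time z * expR (- (s * xi (Num.max 0 z.2) z.1)))%:E.
have mf : measurable_fun setT f.
  apply/measurable_EFinP; apply: measurable_funM; first exact: measurable_nonneg_time.
  apply: measurableT_comp => //; apply: measurableT_comp => //.
  by apply: measurable_funM => //; exact: (measurable_subordinator_joint P).
have f0 z : (0 <= f z)%E.
  by rewrite lee_fin mulr_ge0 ?expR_ge0// /nonneg_time indicE.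
have := @fubini_tonelli1 _ _ T (measurableTypeR R) R P lebesgue_measure f mf f0.
have := @fubini_tonelli _ _ T (measurableTypeR R) R P lebesgue_measure f mf f0.
rewrite /fubini_F => -> ->.
have Phis0 := laplace_exponent_gt0 P xi Phi sub lap Phi_neq0 s s0.
rewrite -(integral_expR_half_line _ Phis0) [RHS]integral_mkcond.
apply: eq_integral => l _; rewrite patchE /f /nonneg_time/=.
case: ifPn => [l0|l0].
  have {}l0 : 0 <= l by move: l0; rewrite inE/= in_itv/= andbT.
  rewrite -(lap _ _ l0 (ltW s0)); apply: eq_integral => w _.
  by rewrite indicE mem_set/= ?in_itv/= ?l0// mul1r max_r.
by apply: integral0_eq => w _; rewrite indicE (negbTE l0) mul0r.
Qed.

End laplace_potential.

Section functional_equation.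
Context {R : realType} {d d' : measure_display} {S : measurableType d}
  {T' : measurableType d'}.
Variables (rho : {sigma_finite_measure set S -> \bar R}) (g zeta : S -> R) (Phi : R -> R).
Variables (P' : probability T' R) (Rv : T' -> R).
Hypotheses (mg : measurable_fun setT g) (g_ge0 : forall z, 0 <= g z).
Hypothesis mzeta : measurable_fun setT zeta.
Hypothesis Phi_gt0 : forall s, 0 < s -> 0 < Phi s.
Hypothesis Phi_le : forall k, Phi k.+1%:R <= k.+1%:R * Phi 1.
Hypothesis potential : forall s, 0 < s ->
  (\int[rho]_z (g z * expR (- (s * zeta z)))%:E = (Phi s)^-1%:E)%E.
Hypothesis rem : is_remainder P' Phi Rv.

Let mRv : measurable_fun setT Rv. Proof. by case: rem. Qed.
Let Rv_gt0 w : 0 < Rv w. Proof. by case: rem. Qed.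

Local Notation prod := (probability_product P' rho).
Let Y (z : T' * S) : R := Rv z.1 * expR (- zeta z.2).

Let Y_gt0 z : 0 < Y z. Proof. by rewrite mulr_gt0 ?expR_gt0. Qed.

Let mY : measurable_fun setT Y.
Proof.
apply: measurable_funM; first exact: measurableT_comp.
apply: measurableT_comp => //; apply: measurableT_comp => //.
exact: measurableT_comp.
Qed.

(** The s-th power of [Y] splits into a function of each coordinate, so the product measure
    factorises the integral and [potential] evaluates the second factor. *)
Lemma integral_remainder_discounted (s : R) : 0 < s ->
  (\int[prod]_z (g z.2 * Y z `^ s)%:E =
   \int[P']_w (Rv w `^ s)%:E * (Phi s)^-1%:E)%E.
Proof.
move=> s0.
have E z : g z.2 * Y z `^ s = Rv z.1 `^ s * (g z.2 * expR (- (s * zeta z.2))).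
  rewrite /Y powRM ?expR_ge0// ?ltW// -expRM mulrCA; congr (_ * (_ * expR _)).
  by rewrite mulNr mulrC.
under eq_integral do rewrite E.
have me : measurable_fun setT (fun z => g z * expR (- (s * zeta z))).
  apply: measurable_funM => //; apply: measurableT_comp => //.
  by apply: measurableT_comp => //; exact: measurable_funM.
have e0 z : 0 <= g z * expR (- (s * zeta z)) by rewrite mulr_ge0// expR_ge0.
rewrite (@fubini_tonelli1 _ _ T' S R P' rho); last 2 first.
- apply/measurable_EFinP; apply: measurable_funM.
    exact: (measurableT_comp (measurableT_comp (measurable_powR s) mRv)).
  exact: (measurableT_comp me).
- by move=> z; rewrite lee_fin mulr_ge0// powR_ge0.
rewrite -ge0_integralZr//=; last 3 first.
- by apply/measurable_EFinP; exact: (measurableT_comp (measurable_powR s) mRv).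
- by move=> w _; rewrite lee_fin powR_ge0.
- by rewrite lee_fin invr_ge0 ltW// Phi_gt0.
apply: eq_integral => w _; rewrite /fubini_F/=.
under eq_integral do rewrite EFinM.
rewrite ge0_integralZl_EFin//; last 3 first.
- by move=> z _; rewrite lee_fin.
- by apply/measurable_EFinP.
- exact: powR_ge0.
by rewrite potential.
Qed.

Let mom (k : nat) : R := \prod_(1 <= i < k.+1) Phi i%:R.

Let momS k : mom k.+1 = mom k * Phi k.+1%:R.
Proof. by rewrite /mom big_nat_recr. Qed.

Lemma remainder_moment (k : nat) : (\int[P']_w (Rv w ^+ k)%:E = (mom k)%:E)%E.
Proof.
case: rem => _ _ H; case: k => [|k]; last exact: H.
by rewrite /mom big_geq//= integral_probability1.
Qed.

Lemma remainder_moment_gt0 (k : nat) : 0 < mom k.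
Proof.
elim: k => [|k IH]; first by rewrite /mom big_geq.
by rewrite momS mulr_gt0// Phi_gt0.
Qed.

(** Each factor satisfies Phi(k) <= k Phi(1). This is the growth condition of [same_moments], with
    rate [Phi 1] and K = 1. *)
Lemma remainder_moment_le (k : nat) : mom k <= Phi 1 ^+ k * k`!%:R.
Proof.
elim: k => [|k IH]; first by rewrite /mom big_geq// expr0 mul1r fact0.
have -> : Phi 1 ^+ k.+1 * k.+1`!%:R = (Phi 1 ^+ k * k`!%:R) * (k.+1%:R * Phi 1).
  by rewrite exprSr factS natrM; ring.
rewrite momS; apply: ler_pM => //; first exact/ltW/remainder_moment_gt0.
exact/ltW/Phi_gt0.
Qed.

Lemma remainder_functional_equation (r : R) : 0 < r ->
  (\int[P']_w (Rv w `^ (r - 1))%:E =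
   \int[P']_w (Rv w `^ r)%:E * (Phi r)^-1%:E)%E.
Proof.
(* Chosen so that a > 0 and n - a = r - 1. *)
move=> r0; pose n := Num.truncn r; pose a := n.+1%:R - r.
have a0 : 0 < a by rewrite subr_gt0 truncnS_gt.
have M : same_moments P' prod Rv Y (Phi 1) (cst 1) (fun z => g z.2 * Y z) mom.
  split.
  - split=> //; apply: measurable_funM => //.
    exact: measurableT_comp.
  - by split=> // z; rewrite mulr_ge0// ltW.
  - by move=> k; under eq_integral do rewrite mul1r; exact: remainder_moment.
  (* The weight already contains one [Y], so this is the integral of g Y^(k+1), namely m_(k+1) /
     Phi(k+1) = m_k. *)
  - move=> k; under eq_integral.
      move=> z _; rewrite -mulrA -exprS -powR_mulrn ?(ltW (Y_gt0 z))//; over.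
    rewrite integral_remainder_discounted ?ltr0n//.
    under eq_integral do rewrite powR_mulrn ?(ltW (Rv_gt0 _))//.
    by rewrite remainder_moment momS -EFinM mulfK// gt_eqF// Phi_gt0.
  - exists 1 => k; rewrite mul1r; exact: remainder_moment_le.
have := same_moments_powR P' prod Rv Y (Phi 1) _ _ _ a n mRv mY Rv_gt0 Y_gt0
  (Phi_gt0 1 ltr01) a0 M.
rewrite -integral_remainder_discounted//.
have E x b : 0 < x -> x ^+ n * x `^ b = x `^ (n%:R + b).
  move=> x0; rewrite powRD; last by rewrite (gt_eqF x0) implybT.
  by rewrite powR_mulrn// ltW.
under eq_integral do rewrite mul1r E//.
under [X in _ = X -> _]eq_integral => z _.
  rewrite -mulrA E// -mulrA -{1}(powRr1 (ltW (Y_gt0 z))) -powRD; last first.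
    by rewrite (gt_eqF (Y_gt0 z)) implybT.
  over.
have -> : n%:R - a = r - 1 by rewrite /a -natr1; ring.
by rewrite addrCA subrr addr0.
Qed.

End functional_equation.

(** * Gauss product *)

Section gauss_product.
Context {R : realType} (M Phi : R -> R).
Hypothesis M_gt0 : forall r, 0 < r -> 0 < M r.
Hypothesis M1 : M 1 = 1.
Hypothesis M_rec : forall r, 0 < r -> M (r + 1) = Phi r * M r.
Hypothesis M_log_convex : forall x y t, 0 < x -> 0 < y -> 0 <= t <= 1 ->
  M (t * x + (1 - t) * y) <= M x `^ t * M y `^ (1 - t).
Hypothesis Phi_gt0 : forall s, 0 < s -> 0 < Phi s.
Hypothesis Phi_nd : forall s t, 0 < s -> s <= t -> Phi s <= Phi t.
Hypothesis Phi_star : forall s t, 0 < s -> s <= t -> Phi t <= t / s * Phi s.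

Definition gauss_product (r : R) (n : nat) : R :=
  (\prod_(j < n) (Phi j.+1%:R / Phi (j%:R + r))) * Phi n%:R `^ (r - 1).

Lemma prod_functional_equation (r : R) (n : nat) : 0 < r ->
  \prod_(j < n) Phi (j%:R + r) = M (n%:R + r) / M r.
Proof.
move=> r0; elim: n => [|n IH].
  by rewrite big_ord0 add0r divff// gt_eqF// M_gt0.
have nr0 : 0 < n%:R + r by rewrite ltr_wpDl.
by rewrite big_ord_recr/= IH -natr1 addrAC M_rec// mulrC mulrA.
Qed.

(** Numerator and denominator telescope through [M_rec], so convergence to [M r] means that the
    second factor tends to 1. *)
Lemma gauss_productE (r : R) (n : nat) : 0 < r ->
  gauss_product r n = M r * (M (n%:R + 1) / M (n%:R + r) * Phi n%:R `^ (r - 1)).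
Proof.
move=> r0; rewrite /gauss_product big_split/= prodfV prod_functional_equation//.
under eq_bigr do rewrite -natr1.
rewrite prod_functional_equation// M1 divr1 invf_div.
by field; rewrite !gt_eqF ?M_gt0// ltr_wpDl.
Qed.

Lemma gauss_product_bounds (r : R) (n : nat) : 0 < r -> r <= 1 ->
  M r <= gauss_product r n.+1 <= M r * (1 + n.+1%:R^-1).
Proof.
move=> r0 r1; rewrite gauss_productE//.
set N : R := n.+1%:R.
have N0 : 0 < N by rewrite ltr0n.
have Nr0 : 0 < N + r by rewrite addr_gt0.
have N10 : 0 < N + 1 by rewrite addr_gt0.
have PN0 := Phi_gt0 _ N0.
have MNr0 := M_gt0 _ Nr0.
have r1' : 0 <= 1 - r by rewrite subr_ge0.
have r01 : 0 <= r <= 1 by rewrite r1 ltW.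
have r01' : 0 <= 1 - r <= 1 by rewrite r1'/= gerBl ltW.
have powK (x : R) : 0 < x -> x `^ (1 - r) * x `^ r = x.
  move=> x0; rewrite -powRD ?subrK ?powRr1 ?(ltW x0)//.
  by rewrite (gt_eqF x0) implybT.
have powV : Phi N `^ (r - 1) = (Phi N `^ (1 - r))^-1.
  by rewrite -powRN opprB.
have PNr0 : 0 < Phi N `^ (1 - r) by rewrite powR_gt0.
have MN0 := M_gt0 _ N0.
apply/andP; split.
  rewrite (ler_pMr _ (M_gt0 _ r0)) powV ler_pdivlMr// mul1r ler_pdivlMr//.
  (* N + r lies between N and N + 1, hence M(N+r) <= M(N) Phi(N)^r; with M(N+1) = Phi(N) M(N) this
     is the lower bound. *)
  have := M_log_convex N (N + 1) (1 - r) N0 N10 r01'.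
  have -> : (1 - r) * N + (1 - (1 - r)) * (N + 1) = N + r by ring.
  rewrite subKr M_rec// powRM ?(ltW PN0) ?(ltW MN0)// => H.
  apply: le_trans (ler_wpM2l (ltW PNr0) H) _.
  rewrite -{3}(powK _ PN0) -{3}(powK _ MN0) le_eqVlt.
  by apply/orP; left; apply/eqP; ring.
apply: ler_wpM2l; first exact/ltW/M_gt0.
have PNr := Phi_gt0 _ Nr0.
(* N + 1 lies between N + r and N + r + 1, hence M(N+1) <= Phi(N+r)^(1-r) M(N+r). It remains to
   replace Phi(N+r) by Phi(N). *)
have := M_log_convex (N + r) (N + r + 1) r Nr0 (addr_gt0 Nr0 ltr01) r01.
have -> : r * (N + r) + (1 - r) * (N + r + 1) = N + 1 by ring.
rewrite (M_rec (N + r))// powRM ?(ltW PNr) ?(ltW MNr0)//.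
rewrite mulrCA [_ `^ r * _]mulrC powK// => H.
rewrite powV ler_pdivrMr// ler_pdivrMr//.
apply: (le_trans H); rewrite ler_wpM2r ?(ltW MNr0)//.
have ratio : 1 <= (N + r) / N by rewrite ler_pdivlMr// mul1r lerDl ltW.
apply: (@le_trans _ _ (((N + r) / N * Phi N) `^ (1 - r))).
  apply: ge0_ler_powR => //; rewrite ?nnegrE ?(ltW PNr)//.
    by rewrite mulr_ge0 ?(ltW PN0)// (le_trans ler01).
  by apply: Phi_star => //; rewrite lerDl ltW.
rewrite powRM ?(ltW PN0) ?(le_trans ler01 ratio)// ler_wpM2r ?(ltW PNr0)//.
(* The ratio is at least 1 and the exponent 1 - r at most 1, so the power is at most the ratio 1 +
   r/N. *)
apply: (@le_trans _ _ ((N + r) / N)).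
  by rewrite ler1_powR// gerBl ltW.
by rewrite mulrDl divff ?gt_eqF// lerD2l ler_piMl// invr_ge0 ltW.
Qed.

(** Raising [r] by one multiplies the product by Phi(r) and by a ratio tending to 1, which carries
    the limit from (0, 1] to all positive [r]. *)
Lemma gauss_product_step (r : R) (n : nat) : 0 < r ->
  gauss_product (r + 1) n.+1 =
  gauss_product r n.+1 * (Phi r * (Phi n.+1%:R / Phi (n.+1%:R + r))).
Proof.
move=> r0; rewrite !gauss_productE//; last exact: addr_gt0.
set N : R := n.+1%:R.
have N0 : 0 < N by rewrite ltr0n.
have Nr0 : 0 < N + r by rewrite addr_gt0.
rewrite addrA !M_rec// addrK.
have <- : Phi N * Phi N `^ (r - 1) = Phi N `^ r.
  by rewrite mulr_powRB1// ltW// Phi_gt0.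
by field; rewrite !gt_eqF ?M_gt0 ?Phi_gt0.
Qed.

(** Monotonicity bounds the ratio by 1 from above, star-shapedness by 1 / (1 + r/N) from below. *)
Lemma Phi_ratio_cvg (r : R) : 0 < r ->
  Phi n.+1%:R / Phi (n.+1%:R + r) @[n --> \oo] --> (1 : R).
Proof.
move=> r0; apply: (@squeeze_cvgr _ _ _ _ (fun n => (1 + r * n.+1%:R^-1)^-1) (cst 1)).
- apply: nearW => n; set N : R := n.+1%:R.
  have N0 : 0 < N by rewrite ltr0n.
  have Nr0 : 0 < N + r by rewrite addr_gt0.
  have PNr := Phi_gt0 _ Nr0.
  have PN := Phi_gt0 _ N0.
  apply/andP; split; last first.
    by rewrite ler_pdivrMr// mul1r Phi_nd// lerDl ltW.
  rewrite ler_pdivlMr// ler_pdivrMl; last first.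
    by rewrite addr_gt0// divr_gt0.
  have -> : 1 + r / N = (N + r) / N by field; rewrite gt_eqF.
  by apply: Phi_star => //; rewrite lerDl ltW.
- rewrite -[X in _ --> X]invr1; apply: cvgV; first exact: oner_neq0.
  rewrite -[X in _ --> X]addr0 -[X in 1 + X](mulr0 r).
  apply: cvgD; first exact: cvg_cst.
  by apply: cvgM; [exact: cvg_cst|exact: cvg_harmonic].
- exact: cvg_cst.
Qed.

Lemma gauss_product_cvg (r : R) : 0 < r -> gauss_product r n @[n --> \oo] --> M r.
Proof.
(* The bounds start at index 1, since they need [Phi] at a positive argument. *)
move=> r0; rewrite -(cvg_shiftS (gauss_product r)).
suff H k : forall r, 0 < r -> r <= k.+1%:R -> gauss_product r n.+1 @[n --> \oo] --> M r.
  by apply: (H (Num.truncn r)) => //; rewrite ltW// truncnS_gt.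
have base s : 0 < s -> s <= 1 -> gauss_product s n.+1 @[n --> \oo] --> M s.
  move=> s0 s1.
  apply: (@squeeze_cvgr _ _ _ _ (cst (M s)) (fun n => M s * (1 + n.+1%:R^-1))).
  - by apply: nearW => n; exact: gauss_product_bounds.
  - exact: cvg_cst.
  - rewrite -[X in _ --> X]mulr1; apply: cvgM; first exact: cvg_cst.
    rewrite -[X in _ --> X]addr0.
    by apply: cvgD; [exact: cvg_cst|exact: cvg_harmonic].
elim: k => [|k IH] s s0 sk; first exact: base.
have [s1|s1] := leP s 1; first exact: base.
have t0 : 0 < s - 1 by rewrite subr_gt0.
rewrite -(subrK 1 s) M_rec//.
under eq_fun do rewrite gauss_product_step//.
have -> : Phi (s - 1) * M (s - 1) = M (s - 1) * (Phi (s - 1) * 1).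
  by rewrite mulr1 mulrC.
apply: cvgM; first by apply: IH => //; rewrite lerBlDr natr1.
by apply: cvgM; [exact: cvg_cst|exact: Phi_ratio_cvg].
Qed.

End gauss_product.

(** * Mellin transform of the remainder and the limit formula *)

Section remainder.
Context {R : realType} {d d' : measure_display} {T : measurableType d}
  {T' : measurableType d'}.
Variables (P : probability T R) (xi : R -> T -> R) (Phi : R -> R).
Variables (P' : probability T' R) (Rv : T' -> R).
Hypothesis sub : subordinator P xi.
Hypothesis lap : laplace_exponent P xi Phi.
Hypothesis Phi_neq0 : exists s, 0 <= s /\ Phi s != 0.
Hypothesis rem : is_remainder P' Phi Rv.

Definition remainder_mellin (r : R) : R := fine (\int[P']_w (Rv w `^ (r - 1))%:E).

Let mRv : measurable_fun setT Rv. Proof. by case: rem. Qed.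
Let Rv_gt0 w : 0 < Rv w. Proof. by case: rem. Qed.
Let Phi_gt0 := laplace_exponent_gt0 P xi Phi sub lap Phi_neq0.

Let mpow (a : R) : measurable_fun setT (fun w => Rv w `^ a).
Proof. exact: (measurableT_comp (measurable_powR a) mRv). Qed.

(** Kept in the extended reals: for r < 1 the exponent on the left is negative, and finiteness there
    is deduced from this equation. *)
Lemma remainder_mellin_rec_ereal (r : R) : 0 < r ->
  (\int[P']_w (Rv w `^ (r - 1))%:E = \int[P']_w (Rv w `^ r)%:E * (Phi r)^-1%:E)%E.
Proof.
apply: (remainder_functional_equation (probability_product P (@lebesgue_measure R))
  nonneg_time (fun z => xi (Num.max 0 z.2) z.1)) => //.
- exact: measurable_nonneg_time.
- exact: (measurable_subordinator_joint P).
- move=> k; have := laplace_exponent_star_shaped P xi Phi sub lap 1 k.+1%:R ltr01.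
  by rewrite ler1n divr1; apply.
- exact: (integral_laplace_potential P xi Phi sub lap Phi_neq0).
Qed.

(** The power is dominated by 1 plus an integer power of order above [a], whose expectation is a
    known moment. *)
Lemma remainder_power_fin_num (a : R) : 0 <= a ->
  (\int[P']_w (Rv w `^ a)%:E)%E \is a fin_num.
Proof.
move=> a0; pose n := Num.truncn a.
rewrite ge0_fin_numE; last by apply: integral_ge0 => w _; rewrite lee_fin powR_ge0.
apply: (@le_lt_trans _ _ (\int[P']_w (1%:E + (Rv w ^+ n.+1)%:E))%E).
  apply: ge0_le_integral => //.
  - by move=> w _; rewrite lee_fin powR_ge0.
  - exact/measurable_EFinP.
  - apply: emeasurable_funD => //; apply/measurable_EFinP.
    exact: measurable_funX.
  - move=> w _; rewrite -EFinD lee_fin.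
    have [w1|w1] := leP (Rv w) 1.
      have : Rv w `^ a <= Rv w `^ 0 by rewrite ger_powR// Rv_gt0.
      by rewrite powRr0 => /le_trans; apply; rewrite lerDl exprn_ge0// ltW.
    rewrite -(powR_mulrn _ (ltW (Rv_gt0 w))).
    apply: (@le_trans _ _ (Rv w `^ n.+1%:R)); last by rewrite lerDr.
    by rewrite ler_powR ?(ltW w1)// ltW// truncnS_gt.
rewrite ge0_integralD//; last 2 first.
- by move=> w _; rewrite lee_fin exprn_ge0// ltW.
- by apply/measurable_EFinP; exact: measurable_funX.
have [_ _ ->] := rem; last by [].
by rewrite integral_probability1 -EFinD ltry.
Qed.

Lemma remainder_mellinE (r : R) : 0 < r ->
  (\int[P']_w (Rv w `^ (r - 1))%:E = (remainder_mellin r)%:E)%E.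
Proof.
move=> r0; rewrite /remainder_mellin fineK// remainder_mellin_rec_ereal//.
by rewrite fin_numM// remainder_power_fin_num// ltW.
Qed.

Lemma remainder_mellin_gt0 (r : R) : 0 < r -> 0 < remainder_mellin r.
Proof.
move=> r0; rewrite -lte_fin -remainder_mellinE//; apply: integral_gt0 => //.
- by rewrite [X in X != _](@probability_setT _ _ _ P') eqe oner_eq0.
- by move=> w; rewrite powR_gt0.
Qed.

Lemma remainder_mellin1 : remainder_mellin 1 = 1.
Proof.
rewrite /remainder_mellin subrr; under eq_integral do rewrite powRr0.
by rewrite integral_probability1.
Qed.

Lemma remainder_mellin_rec (r : R) : 0 < r ->
  remainder_mellin (r + 1) = Phi r * remainder_mellin r.
Proof.
move=> r0.
have -> : remainder_mellin r = remainder_mellin (r + 1) / Phi r.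
  apply: EFin_inj; rewrite EFinM -!remainder_mellinE ?addr_gt0// addrK.
  exact: remainder_mellin_rec_ereal.
by rewrite mulrCA divff ?mulr1// gt_eqF// Phi_gt0.
Qed.

Lemma remainder_mellin_log_convex (x y t : R) : 0 < x -> 0 < y -> 0 <= t <= 1 ->
  remainder_mellin (t * x + (1 - t) * y) <=
  remainder_mellin x `^ t * remainder_mellin y `^ (1 - t).
Proof.
move=> x0 y0 t01.
(* AM-GM gives positivity uniformly in [t], endpoints 0 and 1 included. *)
have z0 : 0 < t * x + (1 - t) * y.
  apply: lt_le_trans (weighted_AMGM x y t x0 y0 t01).
  by rewrite mulr_gt0 ?powR_gt0.
rewrite -lee_fin -remainder_mellinE//.
have := integral_interpolation P' _ _ _ _ t (mpow (x - 1)) (mpow (y - 1))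
  (fun w => powR_gt0 _ (Rv_gt0 w)) (fun w => powR_gt0 _ (Rv_gt0 w))
  (remainder_mellin_gt0 _ x0) (remainder_mellin_gt0 _ y0) t01
  (remainder_mellinE _ x0) (remainder_mellinE _ y0).
apply: le_trans; rewrite le_eqVlt; apply/orP; left; apply/eqP.
apply: eq_integral => w _; rewrite -!powRrM -powRD; last first.
  by rewrite (gt_eqF (Rv_gt0 w)) implybT.
by congr (_ `^ _)%:E; ring.
Qed.

End remainder.

Theorem theorem2p3 (R : realType)
  (d : measure_display) (T : measurableType d) (P : probability T R)
  (xi : R -> T -> R) (Phi : R -> R)
  (d' : measure_display) (T' : measurableType d') (P' : probability T' R)
  (Rv : T' -> R) :
  subordinator P xi ->
  laplace_exponent P xi Phi ->
  (exists s, 0 <= s /\ Phi s != 0) ->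
  is_remainder P' Phi Rv ->
  forall r : R, 0 < r ->
    (fun n : nat =>
       ((\prod_(j < n) (Phi j.+1%:R / Phi (j%:R + r))) *
        Phi n%:R `^ (r - 1))%:E)
      @ \oo --> (\int[P']_w ((Rv w) `^ (r - 1))%:E)%E.
Proof.
move=> sub lap Phi_neq0 rem r r0.
rewrite (remainder_mellinE P xi Phi P' Rv)//.
apply: cvg_EFin; first exact: nearW.
apply: (gauss_product_cvg (remainder_mellin P' Rv)) => //.
- exact: (remainder_mellin_gt0 P xi Phi).
- exact: remainder_mellin1.
- exact: (remainder_mellin_rec P xi Phi).
- exact: (remainder_mellin_log_convex P xi Phi).
- exact: (laplace_exponent_gt0 P xi).
- by move=> s t s0; apply: (laplace_exponent_nondecreasing P xi) => //; exact: ltW.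
- exact: (laplace_exponent_star_shaped P xi).
Qed.
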